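(* With notation as in the context: (1) For $G=T$: $\det M_0(t)=(1-t)^3\,\Delta^-_{2,3,3}(t)$ and $\det M(t)=(1-t)^4\,\Delta_{2,2,3,3}(t)$. (2) For $G=O$: $\det M_0(t)=(1-t)^3(1-t^2)\,\Delta^-_{2,3,4}(t)$ and $\det M(t)=(1-t)^4(1-t^2)\,\Delta_{2,2,3,4}(t)$. (3) For $G=I$: $\det M_0(t)=(1-t)^4\,\Delta^-_{2,3,5}(t)$ and $\det M(t)=(1-t)^5\,\Delta_{2,2,3,5}(t)$.
   Context: For a finite group $G\subset\mathrm{SL}_3(\mathbb{C})$: let $\gamma$ be its natural 3-dimensional representation, $\gamma^*$ the contragredient representation, $\gamma_0,\dots,\gamma_l$ the irreducible complex representations of $G$ with $\gamma_0$ trivial. Define $(l+1)\times(l+1)$ integer matrices $B=(b_{ij})$, $B^*=(b^*_{ij})$ by $\gamma_j\otimes\gamma=\bigoplus_i b_{ij}\gamma_i$, $\gamma_j\otimes\gamma^*=\bigoplus_i b^*_{ij}\gamma_i$. Let $M(t)=(1-t^3)I-tB+t^2B^*$ and let $M_0(t)$ be obtained from $M(t)$ by replacing the column indexed by $\gamma_0$ with $(1,0,\dots,0)^t$ ($\gamma_0$ first). (These determinants do not depend on the ordering of the irreducibles other than $\gamma_0$, nor on replacing $G$ by a conjugate.) For positive integers $\alpha_1,\dots,\alpha_m$ write $[\alpha]_t=(1-t^\alpha)/(1-t)=1+t+\dots+t^{\alpha-1}$ and define $\Delta^-_{\alpha_1,\dots,\alpha_m}(t)=(1+t)\prod_{i=1}^m[\alpha_i]_t-t\sum_{i=1}^m[\alpha_i-1]_t\prod_{j\ne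 i}[\alpha_j]_t$, $\Delta_{\alpha_1,\dots,\alpha_m}(t)=(1-t)^{2-m}\prod_{i=1}^m(1-t^{\alpha_i})$, $\Delta^+_{\alpha_1,\dots,\alpha_m}(t)=(1-2t-2t^2+t^3)\prod_{i=1}^m[\alpha_i]_t+t^2\sum_{i=1}^m[\alpha_i-1]_t\prod_{j\ne i}[\alpha_j]_t$. (These are the characteristic polynomials of Coxeter elements for the graphs $T^-$, $T$, $T^+$ with arms of lengths $\alpha_i$.) Groups: $T\subset\mathrm{SL}_3(\mathbb{C})$ is the tetrahedral group of order 12, i.e. the image of the irreducible 3-dimensional representation of $A_4$ (equivalently the group $\Delta(12)$ generated by the diagonal matrices $\mathrm{diag}(\pm1,\pm1,\pm1)$ of determinant 1 and the cyclic permutation matrix). $O$ is the octahedral group of order 24, the rotation group of the cube (image of $S_4$ in $\mathrm{SO}(3)$). $I$ is the icosahedral group of order 60, the image of an irreducible 3-dimensional representation of $A_5$ (rotation group of the icosahedron). *)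

(* Defs.v *)
From HB Require Import structures.
From mathcomp Require Import all_boot all_order all_algebra all_fingroup all_solvable all_field all_character.
Set Implicit Arguments. Unset Strict Implicit. Unset Printing Implicit Defensive.
Import Order.TTheory GRing.Theory Num.Theory.
Local Open Scope ring_scope.

Section McKay.
Variables (gT : finGroupType) (G : {group gT}) (gamma : 'CF(G)).

(* b_{ij} = multiplicity of chi_i in chi_j * gamma  (gamma_j (x) gamma) *)
Definition Bmx : 'M[algC]_(Nirr G) :=
  \matrix_(i, j) '['chi_j * gamma, 'chi_i].
(* b*_{ij} = multiplicity of chi_i in chi_j * gamma^*  (contragredient) *)
Definition Bsmx : 'M[algC]_(Nirr G) :=
  \matrix_(i, j) '['chi_j * (gamma^*)%CF, 'chi_i].

(* M(t) = (1 - t^3) I - t B + t^2 B^* *)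
Definition Mt : 'M[{poly algC}]_(Nirr G) :=
  \matrix_(i, j) ((i == j)%:R * (1 - 'X^3) - 'X * (Bmx i j)%:P
                  + 'X^2 * (Bsmx i j)%:P).

(* M_0(t): column of the trivial character chi_0 replaced by (1,0,...,0)^t *)
Definition M0t : 'M[{poly algC}]_(Nirr G) :=
  \matrix_(i, j) (if j == 0 then (i == 0)%:R else Mt i j).
End McKay.

(* [a]_t = 1 + t + ... + t^(a-1) *)
Definition qint (a : nat) : {poly algC} := \sum_(k < a) 'X^k.

Definition Delta_minus (al : seq nat) : {poly algC} :=
  (1 + 'X) * \prod_(a <- al) qint a
  - 'X * \sum_(i < size al) (qint (nth 0 al i).-1 *
        \prod_(j < size al | j != i) qint (nth 0 al j)).

(* Delta_al(t) = (1-t)^(2-m) prod (1 - t^(a_i)); since 1 - t^a = (1-t)[a]_t,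
   this equals (1-t)^2 prod [a_i]_t, a genuine polynomial. *)
Definition Delta (al : seq nat) : {poly algC} :=
  (1 - 'X) ^+ 2 * \prod_(a <- al) qint a.

Definition Delta_plus (al : seq nat) : {poly algC} :=
  (1 - 2%:R * 'X - 2%:R * 'X^2 + 'X^3) * \prod_(a <- al) qint a
  + 'X^2 * \sum_(i < size al) (qint (nth 0 al i).-1 *
        \prod_(j < size al | j != i) qint (nth 0 al j)).

(* A 3-dimensional representation landing in SL_3(C) *)
Definition det_one (gT : finGroupType) (G : {group gT})
  (rG : mx_representation algC G 3) : Prop :=
  forall g, g \in G -> \det (rG g) = 1.

(* Main.v *)
(* The rows of the character table X diagonalise M(t): X^T M(t) = D X^T, where
   the entry of D at the class of g is
   1 - t^3 - t gamma(g) + t^2 conj(gamma(g)).  Hence det M(t) is the product of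
   these entries, and the (0,0) cofactor det M_0(t) satisfies
   |G| det M_0(t) = sum over classes C of |C| times the product of the entries
   at the other classes (Molien's formula times det M(t)).

   Only the class sizes and the values of gamma are then needed.  For
   g in SL_3, Cayley-Hamilton gives gamma(g^2) = gamma(g)^2 - 2 conj(gamma(g)),
   so an involution takes the value -1 or 3; together with the norm condition
   sum |gamma|^2 = |G| this determines gamma completely, up to the choice of
   golden ratio on the 5-cycles of A_5. *)
Require Import Defs.
From HB Require Import structures.
From mathcomp Require Import all_boot all_order all_algebra all_fingroup all_solvable all_field all_character.
From mathcomp Require Import ring.
Import Order.TTheory GRing.Theory Num.Theory.
Local Open Scope ring_scope.
Set Implicit Arguments. Unset Strict Implicit. Unset Printing Implicit Defensive.

(** * The determinants in terms of conjugacy classes *)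

Definition mckay_eig (z : algC) : {poly algC} :=
  1 - 'X^3 - 'X * z%:P + 'X^2 * (z^*)%:P.

(** The constant term is 1. This lets [det_M0t] cancel an eigenvalue. *)
Lemma mckay_eig_neq0 z : mckay_eig z != 0.
Proof.
apply/eqP => /(congr1 (horner^~ 0)) /eqP.
by rewrite /mckay_eig !hornerE !expr0n /= !mul0r subr0 subr0 addr0 oner_eq0.
Qed.

Lemma mckay_eigX z : z^* = z -> mckay_eig z = 1 - 'X^3 - ('X - 'X^2) * z%:P.
Proof. by rewrite /mckay_eig => ->; ring. Qed.

Lemma mckay_eig_nat n : mckay_eig n%:R = 1 - 'X^3 - ('X - 'X^2) * n%:R.
Proof. by rewrite mckay_eigX ?rmorph_nat. Qed.

Lemma mckay_eigN1 : mckay_eig (-1) = 1 - 'X^3 + ('X - 'X^2).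
Proof. by rewrite mckay_eigX ?rmorphN1 ?mulrN1 ?opprK. Qed.

Section McKayDeterminants.
Variables (gT : finGroupType) (G : {group gT}) (gamma : 'CF(G)).

Let Y : 'M[{poly algC}]_(Nirr G) := (map_mx polyC (character_table G))^T.
Let p (i : Iirr G) := mckay_eig (gamma (repr (irr_class i))).

(** Column [j] of [Bmx gamma] holds the coordinates of ['chi_j * gamma] in the basis of
    irreducibles. Pairing it with the values of the irreducibles at [x] gives back
    ['chi_j x * gamma x], so each row of [Y] is a left eigenvector. *)
Lemma character_table_mul_Mt : Y *m Mt gamma = diag_mx (\row_i p i) *m Y.
Proof.
have expand (phi : 'CF(G)) x : phi x = \sum_i '[phi, 'chi_i] * 'chi_i x.
  rewrite {1}[phi]cfun_sum_cfdot sum_cfunE; apply: eq_bigr => i _.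
  by rewrite !cfunE.
apply/matrixP=> c j; rewrite mul_diag_mx !mxE.
set x := repr (irr_class c).
transitivity (\sum_i (('chi_i x)%:P * ((i == j)%:R * (1 - 'X^3)) -
    'X * ('['chi_j * gamma, 'chi_i] * 'chi_i x)%:P +
    'X^2 * ('['chi_j * gamma^*%CF, 'chi_i] * 'chi_i x)%:P)).
  apply: eq_bigr => i _; rewrite !mxE !polyCM -/x; ring.
rewrite big_split sumrB /= -!mulr_sumr -!rmorph_sum -!expand.
rewrite (bigD1 j) //= eqxx big1 => [|i /negbTE->]; last by rewrite mul0r mulr0.
by rewrite /p /mckay_eig -/x !cfunE !polyCM mul1r addr0; ring.
Qed.

Lemma det_Mt :
  \det (Mt gamma) = \prod_(C in classes G) mckay_eig (gamma (repr C)).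
Proof.
have Y0 : \det Y != 0.
  rewrite det_tr det_map_mx polyC_eq0 -unitfE -unitmxE.
  exact: character_table_unit.
apply: (mulfI Y0); rewrite -det_mulmx character_table_mul_Mt det_mulmx mulrC.
rewrite det_diag reindex_irr_class; congr (_ * _).
by apply: eq_bigr => i _; rewrite mxE.
Qed.

Lemma det_M0t :
  #|G|%:R * \det (M0t gamma) = \sum_(C in classes G) #|C|%:R *
    \prod_(C' in classes G | C' != C) mckay_eig (gamma (repr C')).
Proof.
(* Expansion along the replaced column leaves one cofactor, which avoids that column and so is the
   same for [Mt]. *)
have ->: \det (M0t gamma) = (\adj (Mt gamma)) 0 0.
  rewrite (expand_det_col _ 0) (bigD1 0) //= big1 ?addr0 => [|i /negbTE i0].
    rewrite !mxE eqxx mul1r /cofactor; congr (_ * \det _).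
    by apply/matrixP=> i j; rewrite !mxE.
  by rewrite !mxE eqxx i0 mul0r.
(* The trivial character is 1 on every class, so entry [(c, 0)] of
   [Y *m Mt gamma *m \adj (Mt gamma)] is the full determinant. Diagonalisation writes it as the
   eigenvalue at [c] times the wanted entry. *)
have YA c : (Y *m \adj (Mt gamma)) c 0 =
    \prod_(C' in classes G | C' != irr_class c) mckay_eig (gamma (repr C')).
  apply: (mulfI (mckay_eig_neq0 (gamma (repr (irr_class c))))).
  transitivity (\det (Mt gamma)); last first.
    by rewrite det_Mt (bigD1 (irr_class c)) ?irr_classP.
  have /matrixP/(_ c 0) := congr1 (mulmx^~ (\adj (Mt gamma))) character_table_mul_Mt.
  rewrite -!mulmxA mul_mx_adj mul_mx_scalar mul_diag_mx !mxE => <-.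
  have /repr_classesP[Gx _] := irr_classP c.
  by rewrite irr0 cfun1E Gx mulr1.
rewrite reindex_irr_class; under eq_bigr do rewrite -YA mxE mulr_sumr.
(* Orthogonality to the trivial character: weighting rows by class sizes kills every column of [Y]
   but the first, which isolates entry [(0, 0)] of the adjugate. *)
have sumY i : \sum_(c < Nirr G) #|irr_class c|%:R * Y c i = #|G|%:R * (i == 0)%:R.
  have -> : #|G|%:R * (i == 0)%:R = (#|G|%:R * '['chi_i, 'chi_0])%:P :> {poly algC}.
    by rewrite polyCM cfdot_irr !rmorph_nat.
  rewrite cfdotE mulVKf ?neq0CG //.
  rewrite sum_by_classes => [|x y Gx Gy]; last by rewrite !cfunJ.
  rewrite reindex_irr_class rmorph_sum; apply: eq_bigr => c _ /=.
  have /repr_classesP[Gx _] := irr_classP c.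
  by rewrite !mxE polyCM rmorph_nat irr0 cfun1E Gx conjC1 mulr1.
rewrite exchange_big (eq_bigr (fun i => #|G|%:R * ((i == 0)%:R *
    (\adj (Mt gamma)) i 0))) => [|i _] /=; last first.
  by rewrite mulrA -sumY mulr_suml; apply: eq_bigr => c _; rewrite mulrA.
rewrite -mulr_sumr (bigD1 0) //= mul1r big1 ?addr0 // => i /negbTE ->.
by rewrite mul0r.
Qed.

End McKayDeterminants.

(** * Class sums and products over a list of representatives *)

Section ClassRepresentatives.
Variables (gT : finGroupType) (G : {group gT}) (T : eqType) (f : T -> gT).
Variable cs : seq T.
Hypothesis csU : uniq cs.
Hypothesis csI : {in cs &, injective (fun c => f c ^: G)%g}.
Hypothesis csE : classes G =i [seq f c ^: G | c <- cs]%g.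

Lemma big_classes (R : Type) (idx : R) (op : Monoid.com_law idx) P F :
  \big[op/idx]_(C in classes G | P C) F C =
  \big[op/idx]_(c <- cs | P (f c ^: G)%g) F (f c ^: G)%g.
Proof.
rewrite -(big_map (fun c => f c ^: G)%g P F) big_mkcondr [RHS]big_mkcond big_uniq.
  by apply: eq_bigl => C; rewrite csE.
by rewrite map_inj_in_uniq.
Qed.

Lemma det_Mt_reps (gamma : 'CF(G)) :
  \det (Mt gamma) = \prod_(c <- cs) mckay_eig (gamma (f c)).
Proof.
rewrite det_Mt (eq_bigl (fun C => (C \in classes G) && true)); last first.
  by move=> C; rewrite andbT.
by rewrite big_classes; apply: eq_bigr => c _; rewrite cfun_repr.
Qed.

Lemma det_M0t_reps (gamma : 'CF(G)) :
  #|G|%:R * \det (M0t gamma) = \sum_(c <- cs) #|(f c ^: G)%g|%:R *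
    \prod_(d <- cs | d != c) mckay_eig (gamma (f d)).
Proof.
rewrite det_M0t (eq_bigl (fun C => (C \in classes G) && true)); last first.
  by move=> C; rewrite andbT.
rewrite big_classes; apply: eq_big_seq => c cs_c.
rewrite big_classes; congr (_ * _); rewrite big_seq_cond [RHS]big_seq_cond.
apply: eq_big => [d | d _]; last by rewrite cfun_repr.
by apply: andb_id2l => cs_d; rewrite (inj_in_eq csI).
Qed.

Lemma cfnorm_reps (gamma : 'CF(G)) :
  #|G|%:R * '[gamma] = \sum_(c <- cs) #|(f c ^: G)%g|%:R * `|gamma (f c)| ^+ 2.
Proof.
rewrite cfdotE mulVKf ?neq0CG //.
rewrite sum_by_classes => [|x y Gx Gy]; last by rewrite !cfunJ.
rewrite (eq_bigl (fun C => (C \in classes G) && true)); last first.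
  by move=> C; rewrite andbT.
rewrite big_classes; apply: eq_bigr => c _.
by rewrite (cfun_repr gamma) normCK.
Qed.

End ClassRepresentatives.

(** * Three-dimensional characters of determinant one *)

(** Newton's identity p_2 = e_1^2 - 2 e_2 for the eigenvalues: in size 3 the trace of the adjugate
    is e_2. *)
Lemma mxtrace_sqr3 (R : comNzRingType) (A : 'M[R]_3) :
  \tr (A *m A) = \tr A ^+ 2 - 2%:R * \tr (\adj A).
Proof.
rewrite /mxtrace !big_ord_recl !big_ord0 !mxE !big_ord_recl !big_ord0.
rewrite /cofactor !(expand_det_row _ ord0) !big_ord_recl !big_ord0.
rewrite /cofactor !det_mx11 !mxE.
(* With indices in nat, [lift] and [bump] reduce to numerals. *)
have [F AE] : exists F : nat -> nat -> R, forall i j, A i j = F i j.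
  by exists (fun i j => A (inord i) (inord j)) => i j; rewrite !inord_val.
rewrite !AE {A AE} /= /bump /=; ring.
Qed.

Section SL3.
Variables (gT : finGroupType) (G : {group gT}).
Variable rG : mx_representation algC G 3.
Hypothesis rG1 : det_one rG.
Local Notation chi := (cfRepr rG).

(** Determinant one makes the adjugate the inverse matrix, whose trace is the conjugate of
    [chi g]. *)
Lemma cfRepr_sqr g : g \in G -> chi (g * g)%g = chi g ^+ 2 - 2%:R * (chi g)^*.
Proof.
move=> Gg; rewrite -char_inv ?cfRepr_char // !cfunE groupM ?groupV Gg //=.
rewrite repr_mxM // mxtrace_sqr3 !mulr1n; congr (_ - _ * \tr _).
by rewrite repr_mxV // /invmx unitmxE rG1 // unitr1 invr1 scale1r.
Qed.

Lemma cfRepr_real g : g \in G -> (g^-1 \in g ^: G)%g -> (chi g)^* = chi g.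
Proof.
move=> Gg /imsetP[x Gx def_gV].
by rewrite -char_inv ?cfRepr_char // def_gV cfunJ.
Qed.

Lemma cfRepr_involution g : g \in G -> (g * g = 1)%g -> chi g = -1 \/ chi g = 3%:R.
Proof.
move=> Gg gg; have gV : (g^-1 = g)%g by apply/eqP; rewrite eq_invg_mul gg.
have := cfRepr_sqr Gg; rewrite gg cfRepr1 cfRepr_real ?gV ?class_refl // => chi_g.
have /eqP : (chi g + 1) * (chi g - 3%:R) = 0.
  transitivity (chi g ^+ 2 - 2%:R * chi g - 3%:R); first by ring.
  by rewrite -chi_g subrr.
rewrite mulf_eq0 addr_eq0 subr_eq0 => /orP[]/eqP; by [left | right].
Qed.

Hypothesis irrG : mx_irreducible rG.

Lemma cfRepr_norm : '[chi] = 1.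
Proof.
have /irrP[i ->] : chi \in irr G by apply/irr_reprP; exists (Representation rG).
by rewrite cfdot_irr eqxx.
Qed.

End SL3.

(** * Conjugacy classes of permutation groups by computation *)

(* [{perm 'I_n}] does not compute, so conjugacy classes are enumerated on
   one-line words [:: p 0; p 1; ...]. *)
Section Words.
Local Open Scope nat_scope.
Local Open Scope group_scope.
Variable n : nat.
Implicit Types (p q : {perm 'I_n}) (s t : seq nat).

Definition word p : seq nat := [seq val (p i) | i <- enum 'I_n].
(** The left factor acts first, as in [permM]. *)
Definition wmul s t : seq nat := [seq nth 0 t i | i <- s].
Definition winv s : seq nat := [seq index i s | i <- iota 0 n].
Definition words : seq (seq nat) := permutations (iota 0 n).
Definition unword s : {perm 'I_n} := odflt 1 [pick p | word p == s].

Lemma nth_word p (i : 'I_n) : nth 0 (word p) i = p i.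
Proof. by rewrite (nth_map i) ?nth_ord_enum // size_enum_ord. Qed.

Lemma word_inj : injective word.
Proof.
by move=> p q pq; apply/permP=> i; apply/val_inj; rewrite /= -!nth_word pq.
Qed.

Lemma wordK : cancel word unword.
Proof.
by rewrite /unword => p; case: pickP => [q /eqP/word_inj | /(_ p)/eqP].
Qed.

Lemma wordM p q : word (p * q) = wmul (word p) (word q).
Proof.
by rewrite /wmul -map_comp; apply: eq_map => i; rewrite /= nth_word permM.
Qed.

Lemma wordV p : word p^-1 = winv (word p).
Proof.
rewrite /winv -val_enum_ord -map_comp; apply: eq_map => i /=.
rewrite -{2}(permKV p i) (index_map (f := fun j => val (p j))) ?index_enum_ord //.
by move=> j k /val_inj/perm_inj.
Qed.

Lemma mem_words p : word p \in words.
Proof.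
rewrite mem_permutations -val_enum_ord /word (map_comp val p).
apply: perm_map; apply: uniq_perm => [||i].
- by rewrite (map_inj_uniq perm_inj) enum_uniq.
- exact: enum_uniq.
by rewrite mem_enum -{1}(permKV p i) map_f ?mem_enum.
Qed.

(** Surjectivity by counting: [word] is injective, and both sides have n! elements. *)
Lemma unwordK : {in words, cancel unword word}.
Proof.
move=> s; have [|||_ <-] := @uniq_min_size _ [seq word p | p : {perm 'I_n}] words.
- by rewrite map_inj_uniq ?enum_uniq //; apply: word_inj.
- by move=> _ /imageP[p _ ->]; apply: mem_words.
- rewrite size_map -cardE size_permutations ?iota_uniq // size_iota.
  by rewrite -{1}(card_ord n) -card_Sym; apply/eq_leq/eq_card => p; rewrite !inE.
by case/imageP=> p _ ->; rewrite wordK.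
Qed.

Variables (G : {group {perm 'I_n}}) (L : seq (seq nat)).
Hypothesis memG : forall p, (p \in G) = (word p \in L).
Hypothesis subL : {subset L <= words}.

Definition wclass s : seq (seq nat) :=
  undup [seq wmul (winv t) (wmul s t) | t <- L].

Lemma mem_wclass p q : (p \in q ^: G) = (word p \in wclass (word q)).
Proof.
rewrite mem_undup; apply/imsetP/mapP=> [[x Gx ->] | [t Lt def_p]].
  exists (word x); first by rewrite -memG.
  by rewrite conjgE !wordM wordV.
have def_t := unwordK (subL Lt); exists (unword t); first by rewrite memG def_t.
by apply: word_inj; rewrite def_p conjgE !wordM wordV def_t.
Qed.

Lemma card_wclass s : s \in L -> #|unword s ^: G| = size (wclass s).
Proof.
move=> Ls; have Ks := unwordK (subL Ls).
rewrite cardE -(size_map word); apply/perm_size/uniq_perm => [||t].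
- by rewrite (map_inj_uniq word_inj) enum_uniq.
- exact: undup_uniq.
apply/mapP/idP => [[p + ->] | ]; first by rewrite mem_enum mem_wclass Ks.
rewrite mem_undup => /mapP[x Lx ->]; have Kx := unwordK (subL Lx).
exists (unword s ^ unword x); last by rewrite conjgE !wordM wordV Kx Ks.
by rewrite mem_enum memJ_class // memG Kx.
Qed.

(** A boolean certificate, decidable by evaluation, that [cs] picks exactly one word from each class
    of the group listed by [L]. *)
Definition wreps (cs : seq (seq nat)) :=
  [&& uniq cs, all (mem L) cs,
      all (fun c => all (fun d => (d \in wclass c) ==> (d == c)) cs) cs
    & all (fun s => has (fun c => s \in wclass c) cs) L].

Variable cs : seq (seq nat).
Hypothesis csP : wreps cs.

Lemma wreps_uniq : uniq cs. Proof. by case/and4P: csP. Qed.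

Lemma wreps_sub : {subset cs <= L}.
Proof. by case/and4P: csP => _ /allP. Qed.

Lemma wreps_inj : {in cs &, injective (fun c => unword c ^: G)}.
Proof.
case/and4P: csP => _ _ /allP csI _ c d cs_c cs_d eq_cd.
apply/esym/eqP/(implyP (allP (csI c cs_c) d cs_d)).
have Kd := unwordK (subL (wreps_sub cs_d)).
have Kc := unwordK (subL (wreps_sub cs_c)).
by rewrite -Kc -{1}Kd -mem_wclass eq_cd class_refl.
Qed.

Lemma wreps_classes : classes G =i [seq unword c ^: G | c <- cs].
Proof.
case/and4P: csP => _ _ _ /allP csE C; apply/imsetP/mapP=> [[x Gx ->] | [c cs_c ->]].
  have := Gx; rewrite memG => /csE/hasP[c cs_c xc]; exists c => //.
  by apply/class_eqP; rewrite mem_wclass unwordK // subL ?wreps_sub.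
exists (unword c) => //.
by rewrite memG unwordK ?subL ?wreps_sub.
Qed.

End Words.

Section Squares.
Local Open Scope nat_scope.
Local Open Scope group_scope.

Lemma words_Sym n (p : {perm 'I_n}) : (p \in 'Sym_('I_n)) = (word p \in words n).
Proof. by rewrite mem_words inE. Qed.

(* For n = 4 and n = 5 every even permutation is a square, so that signs need
   not be computed. *)
Definition squares n := undup [seq wmul s s | s <- words n].

Lemma squares_sub n : {subset squares n <= words n}.
Proof.
move=> t; rewrite mem_undup => /mapP[s Ls ->].
by rewrite -(unwordK Ls) -wordM mem_words.
Qed.

(** Squares are even, so the list lies inside the alternating group; the size hypothesis forces
    equality. *)
Lemma squares_Alt n : (1 < n)%N -> (2 * size (squares n) = n`!)%N ->
  forall p : {perm 'I_n}, (p \in 'Alt_('I_n)) = (word p \in squares n).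
Proof.
move=> n_gt1 sz_n p.
have := @card_Alt 'I_n; rewrite card_ord => /(_ n_gt1); rewrite -sz_n => /eqP.
rewrite eqn_pmul2l // => /eqP cardA.
have [|||_ Asq] := @uniq_min_size _ (squares n) [seq word q | q in 'Alt_('I_n)].
- exact: undup_uniq.
- move=> t; rewrite mem_undup => /mapP[s Ls ->]; apply/imageP.
  exists (unword n s * unword n s); last by rewrite wordM unwordK.
  by rewrite Alt_even odd_permM addbb.
- by rewrite size_map -cardE cardA.
by rewrite Asq mem_map ?mem_enum //; apply: word_inj.
Qed.

End Squares.

(** * Determinants and norm from class sizes and character values *)

Section WordCharacters.
Variables (n : nat) (G : {group {perm 'I_n}}) (L : seq (seq nat)).
Hypothesis memG : forall p, (p \in G) = (word p \in L).
Hypothesis subL : {subset L <= words n}.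
Variable cs : seq (seq nat).
Hypothesis csP : wreps n L cs.
Variables (gamma : 'CF(G)) (sz : seq nat) (v : seq algC).
Hypothesis szP : [seq size (wclass n L c) | c <- cs] = sz.
Hypothesis vP : [seq gamma (unword n c) | c <- cs] = v.

Let csU := wreps_uniq csP.
Let csI := wreps_inj memG subL csP.
Let csE := wreps_classes memG subL csP.

Lemma det_Mt_words : \det (Mt gamma) = \prod_(z <- v) mckay_eig z.
Proof. by rewrite (det_Mt_reps csU csI csE) -vP big_map. Qed.

(** Positions replace representatives, so that sums for concrete lists unfold over ordinals. *)
Lemma class_sum_words (R : pzSemiRingType) (F : nat -> R) :
  \sum_(c <- cs) #|(unword n c ^: G)%g|%:R * F (index c cs) =
  \sum_(i < size v) (nth 0%N sz i)%:R * F i.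
Proof.
rewrite (big_nth [::]) big_mkord -vP -szP size_map; apply: eq_bigr => i _.
rewrite (card_wclass memG subL) ?(wreps_sub csP) ?mem_nth //.
by rewrite (nth_map [::]) ?index_uniq ?(wreps_uniq csP).
Qed.

Lemma det_M0t_words :
  #|G|%:R * \det (M0t gamma) = \sum_(i < size v) (nth 0%N sz i)%:R *
    \prod_(j < size v | j != i) mckay_eig (nth 0 v j).
Proof.
rewrite (det_M0t_reps csU csI csE).
rewrite -(class_sum_words (fun i =>
  \prod_(j < size v | j != i :> nat) mckay_eig (nth 0 v j))).
apply: eq_big_seq => c cs_c; congr (_ * _).
rewrite (big_nth [::]) big_mkord -vP size_map; apply: eq_big => i.
  by rewrite -{1}(nth_index [::] cs_c) nth_uniq // index_mem.
by rewrite (nth_map [::]).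
Qed.

Lemma cfnorm_words :
  #|G|%:R * '[gamma] = \sum_(i < size v) (nth 0%N sz i)%:R * `|nth 0 v i| ^+ 2.
Proof.
rewrite (cfnorm_reps csU csI csE) -(class_sum_words (fun i => `|nth 0 v i| ^+ 2)).
apply: eq_big_seq => c cs_c; congr (_ * _).
by rewrite -vP (nth_map [::]) ?nth_index // index_mem.
Qed.

End WordCharacters.

(** * Relations between character values, checked on words *)

Section WordTraces.
Variables (n : nat) (G : {group {perm 'I_n}}) (L : seq (seq nat)).
Hypothesis memG : forall p, (p \in G) = (word p \in L).
Hypothesis subL : {subset L <= words n}.
Variable rG : mx_representation algC G 3.
Hypothesis rG1 : det_one rG.
Local Notation chi s := (cfRepr rG (unword n s)).

Lemma cfRepr_word1 : chi (iota 0 n) = 3%:R.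
Proof.
rewrite -(cfRepr1 rG); congr (cfRepr rG _); apply: word_inj.
rewrite unwordK ?mem_permutations // -val_enum_ord.
by apply: eq_map => i; rewrite perm1.
Qed.

Lemma cfRepr_wclass s t : t \in L -> s \in wclass n L t -> chi s = chi t.
Proof.
move=> Lt; rewrite mem_undup => /mapP[x Lx ->].
have [Kt Kx] := (unwordK (subL Lt), unwordK (subL Lx)).
rewrite -(cfunJ (cfRepr rG) (unword n t) (y := unword n x)) ?memG ?Kx //.
by congr (cfRepr rG _); rewrite -[RHS](@wordK n) conjgE !wordM wordV Kx Kt.
Qed.

Lemma cfRepr_wsqr s : s \in L -> chi (wmul s s) = chi s ^+ 2 - 2%:R * (chi s)^*.
Proof.
move=> Ls; have Ks := unwordK (subL Ls); rewrite -cfRepr_sqr ?memG ?Ks //.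
by rewrite -[(_ * _)%g](@wordK n) wordM Ks.
Qed.

Lemma cfRepr_wreal s : s \in L -> winv n s \in wclass n L s -> (chi s)^* = chi s.
Proof.
move=> Ls sV; have Ks := unwordK (subL Ls).
apply: cfRepr_real; first by rewrite memG Ks.
by rewrite (mem_wclass memG subL) wordV Ks.
Qed.

(** The premise is one boolean, dischargeable by evaluation: the class of [s] is real and its
    squares lie in the class of [t]. *)
Lemma cfRepr_wsqr_real s t :
  [&& s \in L, t \in L, winv n s \in wclass n L s & wmul s s \in wclass n L t] ->
  chi t = chi s ^+ 2 - 2%:R * chi s.
Proof.
case/and4P=> Ls Lt sV ss; rewrite -{2}(cfRepr_wreal Ls sV) -cfRepr_wsqr //.
exact/esym/cfRepr_wclass.
Qed.

Lemma cfRepr_winvol s : (s \in L) && (wmul s s == iota 0 n) ->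
  chi s = -1 \/ chi s = 3%:R.
Proof.
case/andP=> Ls /eqP ss; have Ks := unwordK (subL Ls).
apply: cfRepr_involution => //; first by rewrite memG Ks.
apply: word_inj; rewrite wordM Ks ss -val_enum_ord.
by apply: eq_map => i; rewrite perm1.
Qed.

End WordTraces.

(** * The three groups *)

Lemma qint0 : qint 0 = 0.
Proof. exact: big_ord0. Qed.

Lemma qintS a : qint a.+1 = qint a + 'X^a.
Proof. exact: big_ord_recr. Qed.

Lemma Delta_minus3 a b c : Delta_minus [:: a; b; c] =
  (1 + 'X) * (qint a * qint b * qint c) -
  'X * (qint a.-1 * qint b * qint c + qint a * qint b.-1 * qint c +
        qint a * qint b * qint c.-1).
Proof.
rewrite /Delta_minus !big_cons big_nil !big_ord_recl big_ord0.
do 3!rewrite [\prod_(_ < _ | _) _]big_mkcond !big_ord_recl big_ord0 /=.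
ring.
Qed.

Lemma natr_mul_inj n (p q : {poly algC}) : (0 < n)%N -> n%:R * p = n%:R * q -> p = q.
Proof.
by move=> n_gt0; apply: mulfI; rewrite -polyC_natr polyC_eq0 pnatr_eq0 -lt0n.
Qed.

(** Refutes wrong candidate values: they leave the norm equation off balance by [n.+1]. *)
Lemma natr_add_nneg_neq0 n (x : algC) : 0 <= x -> n.+1%:R + x <> 0.
Proof. by move=> x0; apply/eqP; rewrite gt_eqF // ltr_wpDr. Qed.

Lemma natr_norm_eq0 n (z : algC) : n.+1%:R * `|z| ^+ 2 = 0 -> z = 0.
Proof.
by move=> /eqP; rewrite mulf_eq0 pnatr_eq0 sqrf_eq0 normr_eq0 => /eqP.
Qed.

(** * Character values forced by the norm equation *)

(** Here [a] is the value at double transpositions, [b] and [c] those at the 3-cycles. For a = -1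
    the first two terms already give 9 + 3 = 12, so the rest vanish; for a = 3 they give 36, which
    is 24 too many. *)
Lemma Alt4_values (a b c : algC) : a = -1 \/ a = 3%:R ->
  12%:R = 3%:R ^+ 2 + 3%:R * `|a| ^+ 2 + 4%:R * `|b| ^+ 2 + 4%:R * `|c| ^+ 2 ->
  [/\ a = -1, b = 0 & c = 0].
Proof.
have nneg k (z : algC) : 0 <= k%:R * `|z| ^+ 2 by rewrite mulr_ge0 ?exprn_ge0.
move=> a_val /esym/eqP; rewrite -subr_eq0 => /eqP.
case: a_val => ->; rewrite ?normrN ?normr_nat ?normr1 => eq0.
  have: 4%:R * `|b| ^+ 2 + 4%:R * `|c| ^+ 2 = 0 by rewrite -[RHS]eq0; ring.
  move/eqP; rewrite paddr_eq0 // => /andP[/eqP b0 /eqP c0].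
  by split=> //; apply: natr_norm_eq0; eassumption.
case: (@natr_add_nneg_neq0 23 (4%:R * `|b| ^+ 2 + 4%:R * `|c| ^+ 2)).
  by rewrite addr_ge0.
by rewrite -[RHS]eq0; ring.
Qed.

(** The values are at double transpositions, transpositions, 3-cycles and 4-cycles. A 4-cycle
    squares to a double transposition, so a = -1 reads (c - 1)^2 = 0; then 9 + 3 + 6 + 6 = 24 leaves
    b = 0. *)
Lemma Sym4_values (a a' b c : algC) : a = -1 \/ a = 3%:R -> a' = -1 \/ a' = 3%:R ->
  a = c ^+ 2 - 2%:R * c ->
  24%:R = 3%:R ^+ 2 + 3%:R * `|a| ^+ 2 + 6%:R * `|a'| ^+ 2 +
    8%:R * `|b| ^+ 2 + 6%:R * `|c| ^+ 2 ->
  [/\ a = -1, a' = -1, b = 0 & c = 1].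
Proof.
have nneg k (z : algC) : 0 <= k%:R * `|z| ^+ 2 by rewrite mulr_ge0 ?exprn_ge0.
move=> a_val a'_val ac /esym/eqP; rewrite -subr_eq0 => /eqP.
case: a_val => a_val; last first.
  rewrite a_val normr_nat => eq0.
  case: (@natr_add_nneg_neq0 11
    (6%:R * `|a'| ^+ 2 + (8%:R * `|b| ^+ 2 + 6%:R * `|c| ^+ 2))).
    by rewrite !addr_ge0.
  by rewrite -[RHS]eq0; ring.
have c1 : c = 1.
  apply/eqP; rewrite -subr_eq0 -sqrf_eq0; apply/eqP.
  by transitivity (c ^+ 2 - 2%:R * c - -1); [ring | rewrite -ac a_val subrr].
rewrite a_val c1; case: a'_val => ->; rewrite ?normrN ?normr_nat ?normr1 => eq0.
  have /natr_norm_eq0 b0 : 8%:R * `|b| ^+ 2 = 0 by rewrite -[RHS]eq0; ring.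
  by [].
case: (@natr_add_nneg_neq0 47 (8%:R * `|b| ^+ 2)) => //.
by rewrite -[RHS]eq0; ring.
Qed.

(** A 3-cycle is conjugate to its square, hence the equation for [b]; squaring swaps the two classes
    of 5-cycles, with values [y] and [z]. *)
Lemma Alt5_values (a b y z : algC) : a = -1 \/ a = 3%:R ->
  b = b ^+ 2 - 2%:R * b -> z = y ^+ 2 - 2%:R * y -> y = z ^+ 2 - 2%:R * z ->
  60%:R = 3%:R ^+ 2 + 15%:R * `|a| ^+ 2 + 20%:R * `|b| ^+ 2 +
    12%:R * `|y| ^+ 2 + 12%:R * `|z| ^+ 2 ->
  [/\ a = -1, b = 0, y ^+ 2 = y + 1 & z = 1 - y].
Proof.
have nneg k (t : algC) : 0 <= k%:R * `|t| ^+ 2 by rewrite mulr_ge0 ?exprn_ge0.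
move=> a_val b_eq z_eq y_eq /esym/eqP; rewrite -subr_eq0 => /eqP.
case: a_val => a_val; last first.
  rewrite a_val normr_nat => eq0.
  case: (@natr_add_nneg_neq0 83
    (20%:R * `|b| ^+ 2 + (12%:R * `|y| ^+ 2 + 12%:R * `|z| ^+ 2))).
    by rewrite !addr_ge0.
  by rewrite -[RHS]eq0; ring.
rewrite a_val normrN normr1.
have /eqP : b * (b - 3%:R) = 0.
  by transitivity (b ^+ 2 - 2%:R * b - b); [ring | rewrite -b_eq subrr].
rewrite mulf_eq0 subr_eq0 => /orP[]/eqP ->; last first.
  rewrite normr_nat => eq0.
  case: (@natr_add_nneg_neq0 143 (12%:R * `|y| ^+ 2 + 12%:R * `|z| ^+ 2)).
    by rewrite !addr_ge0.
  by rewrite -[RHS]eq0; ring.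
(* Eliminating [z] gives a quartic in [y], factored here. *)
have /eqP : y * ((y - 3%:R) * (y ^+ 2 - y - 1)) = 0.
  transitivity (z ^+ 2 - 2%:R * z - y); last by rewrite -y_eq subrr.
  by rewrite z_eq; ring.
rewrite normr0 !mulf_eq0 => /or3P[/eqP y0 | y3 | /eqP y_root] eq0.
(* The one case where the norm sum is too small: 24 instead of 60, hence the sign change. *)
- have z0 : z = 0 by rewrite z_eq y0; ring.
  case: (@natr_add_nneg_neq0 35 0) => //.
  by rewrite -[RHS]oppr0 -[in RHS]eq0 y0 z0 normr0; ring.
- move: y3 eq0; rewrite subr_eq0 => /eqP ->; rewrite normr_nat => eq0.
  case: (@natr_add_nneg_neq0 71 (12%:R * `|z| ^+ 2)) => //.
  by rewrite -[RHS]eq0; ring.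
have y2 : y ^+ 2 = y + 1.
  by apply/eqP; rewrite -subr_eq0 -[X in _ == X]y_root opprD addrA.
by split=> //; rewrite z_eq y2; ring.
Qed.

(** A 3-cycle and its inverse are not conjugate in A_4, so both occur. *)
Definition Alt4_reps : seq (seq nat) :=
  [:: [:: 0; 1; 2; 3]; [:: 1; 0; 3; 2]; [:: 1; 2; 0; 3]; [:: 2; 0; 1; 3]]%N.

Definition Sym4_reps : seq (seq nat) :=
  [:: [:: 0; 1; 2; 3]; [:: 1; 0; 3; 2]; [:: 1; 0; 2; 3]; [:: 1; 2; 0; 3];
      [:: 1; 2; 3; 0]]%N.

(** The last word is the square of the 5-cycle before it, not conjugate to it in A_5. *)
Definition Alt5_reps : seq (seq nat) :=
  [:: [:: 0; 1; 2; 3; 4]; [:: 1; 0; 3; 2; 4]; [:: 1; 2; 0; 3; 4];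
      [:: 1; 2; 3; 4; 0]; [:: 2; 3; 4; 0; 1]]%N.

(** The values 3, -1, 0 have eigenvalues (1-t)^3, (1-t)[2]^2 and (1-t)[3], which accounts for the
    arms 2, 2, 3, 3. *)
Lemma mckay_dets_Alt4 (rG : mx_representation algC ('Alt_('I_4))%G 3) :
     mx_irreducible rG -> det_one rG ->
     \det (M0t (cfRepr rG)) = (1 - 'X) ^+ 3 * Delta_minus [:: 2; 3; 3]%N /\
     \det (Mt (cfRepr rG)) = (1 - 'X) ^+ 4 * Delta [:: 2; 2; 3; 3]%N.
Proof.
move=> irrG rG1; pose L := squares 4; pose chi s := cfRepr rG (unword 4 s).
have memG : forall p, (p \in ('Alt_('I_4))%G) = (word p \in L).
  by apply: squares_Alt.
have subL := @squares_sub 4.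
have csP : wreps 4 L Alt4_reps by vm_compute.
have szP : [seq size (wclass 4 L c) | c <- Alt4_reps] = [:: 1; 3; 4; 4]%N.
  by vm_compute.
have cardG : #|('Alt_('I_4))%G| = 12%N.
  apply/eqP; rewrite -(eqn_pmul2l (isT : 0 < 2)%N).
  by rewrite card_Alt ?card_ord; vm_compute.
have v1 : chi [:: 0; 1; 2; 3]%N = 3%:R by exact: (cfRepr_word1 rG).
have v2 : chi [:: 1; 0; 3; 2]%N = -1 \/ chi [:: 1; 0; 3; 2]%N = 3%:R.
  by apply: (cfRepr_winvol memG subL rG1); vm_compute.
have := cfnorm_words memG subL csP szP (erefl (map chi Alt4_reps)).
rewrite cardG (cfRepr_norm irrG) /= !big_ord_recl big_ord0 /= v1.
rewrite mulr1 mul1r addr0 !addrA normr_nat => /(Alt4_values v2)[{}v2 v3 v4].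
have vP : [seq cfRepr rG (unword 4 c) | c <- Alt4_reps] = [:: 3%:R; -1; 0%:R; 0%:R].
  by rewrite -[LHS]/[:: chi _; chi _; chi _; chi _] v1 v2 v3 v4.
split; last first.
  rewrite (det_Mt_words memG subL csP vP) /Delta !big_cons !big_nil.
  rewrite !mckay_eig_nat mckay_eigN1 !qintS qint0; ring.
apply: (@natr_mul_inj 12 _ _ isT).
rewrite -cardG (det_M0t_words memG subL csP szP vP) cardG /= !big_ord_recl big_ord0.
do 4!rewrite [\prod_(_ < _ | _) _]big_mkcond !big_ord_recl big_ord0 /=.
rewrite !mckay_eig_nat mckay_eigN1 Delta_minus3 /= !qintS qint0; ring.
Qed.

(** The 4-cycles have value 1 and eigenvalue (1-t)(1+t^2); since [4] = [2](1+t^2), the arm 4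
    appears. *)
Lemma mckay_dets_Sym4 (rG : mx_representation algC ('Sym_('I_4))%G 3) :
     mx_irreducible rG -> det_one rG ->
     \det (M0t (cfRepr rG)) =
       (1 - 'X) ^+ 3 * (1 - 'X^2) * Delta_minus [:: 2; 3; 4]%N /\
     \det (Mt (cfRepr rG)) =
       (1 - 'X) ^+ 4 * (1 - 'X^2) * Delta [:: 2; 2; 3; 4]%N.
Proof.
move=> irrG rG1; pose L := words 4; pose chi s := cfRepr rG (unword 4 s).
have memG : forall p, (p \in ('Sym_('I_4))%G) = (word p \in L).
  exact: words_Sym.
have subL : {subset L <= words 4} by [].
have csP : wreps 4 L Sym4_reps by vm_compute.
have szP : [seq size (wclass 4 L c) | c <- Sym4_reps] = [:: 1; 3; 6; 8; 6]%N.
  by vm_compute.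
have cardG : #|('Sym_('I_4))%G| = 24%N by rewrite card_Sym card_ord.
have v1 : chi [:: 0; 1; 2; 3]%N = 3%:R by exact: (cfRepr_word1 rG).
have v2 : chi [:: 1; 0; 3; 2]%N = -1 \/ chi [:: 1; 0; 3; 2]%N = 3%:R.
  by apply: (cfRepr_winvol memG subL rG1); vm_compute.
have v3 : chi [:: 1; 0; 2; 3]%N = -1 \/ chi [:: 1; 0; 2; 3]%N = 3%:R.
  by apply: (cfRepr_winvol memG subL rG1); vm_compute.
have v25 : chi [:: 1; 0; 3; 2]%N =
    chi [:: 1; 2; 3; 0]%N ^+ 2 - 2%:R * chi [:: 1; 2; 3; 0]%N.
  by apply: (cfRepr_wsqr_real memG subL rG1); vm_compute.
have := cfnorm_words memG subL csP szP (erefl (map chi Sym4_reps)).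
rewrite cardG (cfRepr_norm irrG) /= !big_ord_recl big_ord0 /= v1.
rewrite mulr1 mul1r addr0 !addrA normr_nat
  => /(Sym4_values v2 v3 v25)[{}v2 {}v3 v4 v5].
have vP : [seq cfRepr rG (unword 4 c) | c <- Sym4_reps] =
    [:: 3%:R; -1; -1; 0%:R; 1%:R].
  rewrite -[LHS]/[:: chi _; chi _; chi _; chi _; chi _].
  by rewrite v1 v2 v3 v4 v5.
split; last first.
  rewrite (det_Mt_words memG subL csP vP) /Delta !big_cons !big_nil.
  by rewrite !mckay_eig_nat mckay_eigN1 !qintS qint0; ring.
apply: (@natr_mul_inj 24 _ _ isT).
rewrite -cardG (det_M0t_words memG subL csP szP vP) cardG /= !big_ord_recl big_ord0.
do 5!rewrite [\prod_(_ < _ | _) _]big_mkcond !big_ord_recl big_ord0 /=.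
rewrite !mckay_eig_nat mckay_eigN1 Delta_minus3 /= !qintS qint0; ring.
Qed.

Lemma mckay_dets_Alt5 (rG : mx_representation algC ('Alt_('I_5))%G 3) :
     mx_irreducible rG -> det_one rG ->
     \det (M0t (cfRepr rG)) = (1 - 'X) ^+ 4 * Delta_minus [:: 2; 3; 5]%N /\
     \det (Mt (cfRepr rG)) = (1 - 'X) ^+ 5 * Delta [:: 2; 2; 3; 5]%N.
Proof.
move=> irrG rG1; pose L := squares 5; pose chi s := cfRepr rG (unword 5 s).
have memG : forall p, (p \in ('Alt_('I_5))%G) = (word p \in L).
  by apply: squares_Alt; last by vm_compute.
have subL := @squares_sub 5.
have csP : wreps 5 L Alt5_reps by vm_compute.
have szP : [seq size (wclass 5 L c) | c <- Alt5_reps] = [:: 1; 15; 20; 12; 12]%N.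
  by vm_compute.
have cardG : #|('Alt_('I_5))%G| = 60%N.
  apply/eqP; rewrite -(eqn_pmul2l (isT : 0 < 2)%N).
  by rewrite card_Alt ?card_ord; vm_compute.
have v1 : chi [:: 0; 1; 2; 3; 4]%N = 3%:R by exact: (cfRepr_word1 rG).
have v2 : chi [:: 1; 0; 3; 2; 4]%N = -1 \/ chi [:: 1; 0; 3; 2; 4]%N = 3%:R.
  by apply: (cfRepr_winvol memG subL rG1); vm_compute.
have v33 : chi [:: 1; 2; 0; 3; 4]%N =
    chi [:: 1; 2; 0; 3; 4]%N ^+ 2 - 2%:R * chi [:: 1; 2; 0; 3; 4]%N.
  by apply: (cfRepr_wsqr_real memG subL rG1); vm_compute.
have v45 : chi [:: 2; 3; 4; 0; 1]%N =
    chi [:: 1; 2; 3; 4; 0]%N ^+ 2 - 2%:R * chi [:: 1; 2; 3; 4; 0]%N.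
  by apply: (cfRepr_wsqr_real memG subL rG1); vm_compute.
have v54 : chi [:: 1; 2; 3; 4; 0]%N =
    chi [:: 2; 3; 4; 0; 1]%N ^+ 2 - 2%:R * chi [:: 2; 3; 4; 0; 1]%N.
  by apply: (cfRepr_wsqr_real memG subL rG1); vm_compute.
have v4r : (chi [:: 1; 2; 3; 4; 0]%N)^* = chi [:: 1; 2; 3; 4; 0]%N.
  by apply: (cfRepr_wreal memG subL); vm_compute.
have := cfnorm_words memG subL csP szP (erefl (map chi Alt5_reps)).
rewrite cardG (cfRepr_norm irrG) /= !big_ord_recl big_ord0 /= v1.
rewrite mulr1 mul1r addr0 !addrA normr_nat
  => /(Alt5_values v2 v33 v45 v54)[{}v2 v3 y2 v5].
move: v4r y2 v5; set y := chi [:: 1; 2; 3; 4; 0]%N => yr y2 v5.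
have vP : [seq cfRepr rG (unword 5 c) | c <- Alt5_reps] =
    [:: 3%:R; -1; 0%:R; y; 1 - y].
  rewrite -[LHS]/[:: chi _; chi _; chi _; chi _; chi _].
  by rewrite v1 v2 v3 v5.
have y1r : (1 - y)^* = 1 - y by rewrite rmorphB rmorph1 /= yr.
(* [y] is a root of y^2 - y - 1 and [1 - y] is the other. Both determinants are symmetric in the
   two, so the sum and product of their eigenvalues suffice, and either choice of golden ratio is
   covered. *)
have eigD : mckay_eig y + mckay_eig (1 - y) =
    2%:R - 2%:R * 'X^3 - 'X + 'X^2.
  by rewrite (mckay_eigX yr) (mckay_eigX y1r) polyCB polyC1; ring.
(* The product is (1-t)^2 [5], the source of the arm 5. *)
have eigM : mckay_eig y * mckay_eig (1 - y) =
    (1 - 'X) ^+ 2 * (1 + 'X + 'X^2 + 'X^3 + 'X^4).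
  have yy : y%:P * (1 - y%:P) = -1 :> {poly algC}.
    rewrite -polyC1 -polyCB -polyCM -polyCN; congr _%:P.
    by rewrite mulrBr mulr1 -expr2 y2; ring.
  rewrite (mckay_eigX yr) (mckay_eigX y1r) polyCB polyC1.
  transitivity ((1 - 'X^3) ^+ 2 - (1 - 'X^3) * ('X - 'X^2) +
    ('X - 'X^2) ^+ 2 * (y%:P * (1 - y%:P))); first by ring.
  by rewrite yy; ring.
split; last first.
  rewrite (det_Mt_words memG subL csP vP) /Delta !big_cons !big_nil.
  by rewrite mulr1 eigM !mckay_eig_nat mckay_eigN1 !qintS qint0; ring.
apply: (@natr_mul_inj 60 _ _ isT).
rewrite -cardG (det_M0t_words memG subL csP szP vP) cardG /= !big_ord_recl big_ord0.
do 5!rewrite [\prod_(_ < _ | _) _]big_mkcond !big_ord_recl big_ord0 /=.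
(* Both classes of 5-cycles have size 12, so their two terms combine into the sum of the
   eigenvalues; the other three share the product. *)
transitivity ((mckay_eig (-1) * mckay_eig 0%:R +
      15%:R * mckay_eig 3%:R * mckay_eig 0%:R +
      20%:R * mckay_eig 3%:R * mckay_eig (-1)) *
    (mckay_eig y * mckay_eig (1 - y)) +
    12%:R * mckay_eig 3%:R * mckay_eig (-1) * mckay_eig 0%:R *
    (mckay_eig y + mckay_eig (1 - y))).
  by ring.
rewrite eigM eigD !mckay_eig_nat mckay_eigN1 Delta_minus3 /= !qintS qint0.
ring.
Qed.

Theorem theorem2 :
  (* (1) T : the irreducible 3-dim representation of A_4 *)
  (forall rG : mx_representation algC ('Alt_('I_4))%G 3,
     mx_irreducible rG -> det_one rG ->
     \det (M0t (cfRepr rG)) = (1 - 'X) ^+ 3 * Delta_minus [:: 2; 3; 3]%N /\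
     \det (Mt (cfRepr rG)) = (1 - 'X) ^+ 4 * Delta [:: 2; 2; 3; 3]%N) /\
  (* (2) O : the irreducible 3-dim representation of S_4 in SO(3) *)
  (forall rG : mx_representation algC ('Sym_('I_4))%G 3,
     mx_irreducible rG -> det_one rG ->
     \det (M0t (cfRepr rG)) =
       (1 - 'X) ^+ 3 * (1 - 'X^2) * Delta_minus [:: 2; 3; 4]%N /\
     \det (Mt (cfRepr rG)) =
       (1 - 'X) ^+ 4 * (1 - 'X^2) * Delta [:: 2; 2; 3; 4]%N) /\
  (* (3) I : an irreducible 3-dim representation of A_5 *)
  (forall rG : mx_representation algC ('Alt_('I_5))%G 3,
     mx_irreducible rG -> det_one rG ->
     \det (M0t (cfRepr rG)) = (1 - 'X) ^+ 4 * Delta_minus [:: 2; 3; 5]%N /\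
     \det (Mt (cfRepr rG)) = (1 - 'X) ^+ 5 * Delta [:: 2; 2; 3; 5]%N).
Proof.
split; first exact: mckay_dets_Alt4.
split; [exact: mckay_dets_Sym4 | exact: mckay_dets_Alt5].
Qed.
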